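(* Let $(M,d)$ be a complete cone metric space over a real Banach space $E$ with respect to a cone $P\subset E$ with $\operatorname{Int} P\neq\emptyset$, and suppose that $P$ is normal with normal constant $K$. Let $S,T:M\to M$ be mappings such that (a) $T$ is continuous; (b) $S(M)\subset T(M)$; (c) $S$ and $T$ commute, i.e. $STx=TSx$ for all $x\in M$; (d) there is a real number $b$ with $0\le b<1/2$ such that for all $x,y\in M$ $$d(Sx,Sy)\leq b\,[d(Sx,Tx)+d(Sy,Ty)].$$ Then $S$ and $T$ have a unique common fixed point, i.e. there is exactly one $z\in M$ with $Sz=Tz=z$.
   Context: Let $(E,\|\cdot\|)$ be a real Banach space. A subset $P\subset E$ is a cone if: $P$ is closed, nonempty and $P\neq\{0\}$; $ax+by\in P$ for all $x,y\in P$ and all real $a,b\ge 0$; and $P\cap(-P)=\{0\}$. A cone $P$ induces the partial order $x\le y\iff y-x\in P$ on $E$; $x<y$ means $x\le y$ and $x\ne y$; $x\ll y$ means $y-x\in\operatorname{Int}P$, the interior of $P$. It is always assumed that $\operatorname{Int}P\neq\emptyset$. The cone $P$ is normal if there is $K>0$ such that $0\le x\le y$ implies $\|x\|\le K\|y\|$ for all $x,y\in E$; the least such positive $K$ is the normal constant of $P$. A cone metric space (over $E$, $P$) is a nonempty set $M$ with a map $d:M\times M\to E$ such that for all $x,y,z\in M$: $0\le d(x,y)$, with $d(x,y)=0$ iff $x=y$; $d(x,y)=d(y,x)$; $d(x,y)\le d(x,z)+d(z,y)$. A sequence $(x_n)$ in $M$ converges to $x\in M$ if for every $c\in E$ with $0\ll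 c$ there is $n_0$ such that $d(x_n,x)\ll c$ for all $n\ge n_0$; it is Cauchy if for every $c\in E$ with $0\ll c$ there is $n_0$ such that $d(x_n,x_m)\ll c$ for all $n,m\ge n_0$. $(M,d)$ is complete if every Cauchy sequence converges in $M$. Continuity of maps $M\to M$ is with respect to the topology on $M$ having as sub-basis the sets $B(b,c)=\{y\in M: d(y,b)\ll c\}$, with $b\in M$ and $0\ll c$. *)

(* Defs.v *)
From HB Require Import structures.
From mathcomp Require Import all_boot all_order all_algebra.
From mathcomp Require Import all_classical all_reals all_analysis.

Set Implicit Arguments.
Unset Strict Implicit.
Unset Printing Implicit Defensive.

Import Order.TTheory GRing.Theory Num.Theory.
Import numFieldNormedType.Exports.

Local Open Scope classical_set_scope.
Local Open Scope ring_scope.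

Definition is_cone (R : realType) (E : completeNormedModType R) (P : set E) : Prop :=
  [/\ closed P,
      P !=set0,
      P <> [set 0],
      (forall (a b : R) (x y : E),
          0 <= a -> 0 <= b -> P x -> P y -> P (a *: x + b *: y)) &
      P `&` [set - x | x in P] = [set 0]].

Definition cone_le (R : realType) (E : completeNormedModType R) (P : set E)
  (x y : E) : Prop := P (y - x).

Definition cone_ll (R : realType) (E : completeNormedModType R) (P : set E)
  (x y : E) : Prop := interior P (y - x).

Definition normality_bound (R : realType) (E : completeNormedModType R)
  (P : set E) (K : R) : Prop :=
  0 < K /\
  forall x y : E, cone_le P 0 x -> cone_le P x y -> `|x| <= K * `|y|.

Definition normal_cone (R : realType) (E : completeNormedModType R)
  (P : set E) : Prop := exists K : R, normality_bound P K.

Definition is_normal_constant (R : realType) (E : completeNormedModType R)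
  (P : set E) (K : R) : Prop :=
  normality_bound P K /\ forall K' : R, normality_bound P K' -> K <= K'.

Record coneMetricType (R : realType) (E : completeNormedModType R) (P : set E) :=
  ConeMetricType {
    cm_sort :> Type;
    cm_inhabited : inhabited cm_sort;
    cdist : cm_sort -> cm_sort -> E;
    cdist_ge0 : forall x y, cone_le P 0 (cdist x y);
    cdist_eq0 : forall x y, cdist x y = 0 <-> x = y;
    cdist_sym : forall x y, cdist x y = cdist y x;
    cdist_triangle : forall x y z,
      cone_le P (cdist x y) (cdist x z + cdist z y)
  }.

Definition cone_ball (R : realType) (E : completeNormedModType R) (P : set E)
  (M : coneMetricType P) (b : M) (c : E) : set M :=
  [set y | cone_ll P (cdist y b) c].

Definition cone_balls (R : realType) (E : completeNormedModType R) (P : set E)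
  (M : coneMetricType P) : set (set M) :=
  [set B | exists (b : M) (c : E), cone_ll P 0 c /\ B = cone_ball b c].
Arguments cone_balls {R E P} M.

(* The topology of M with sub-basis the cone balls: it becomes the canonical
   topology on the carrier, to which [continuous] refers. *)
HB.instance Definition _ (R : realType) (E : completeNormedModType R) (P : set E)
  (M : coneMetricType P) := gen_eqMixin (cm_sort M).
HB.instance Definition _ (R : realType) (E : completeNormedModType R) (P : set E)
  (M : coneMetricType P) := gen_choiceMixin (cm_sort M).
HB.instance Definition _ (R : realType) (E : completeNormedModType R) (P : set E)
  (M : coneMetricType P) :=
  @isSubBaseTopological.Build (cm_sort M) (set M) (cone_balls M) id.

Definition cone_cvg (R : realType) (E : completeNormedModType R) (P : set E)
  (M : coneMetricType P) (u : nat -> M) (x : M) : Prop :=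
  forall c : E, cone_ll P 0 c ->
    exists n0 : nat, forall n : nat, (n0 <= n)%N -> cone_ll P (cdist (u n) x) c.

Definition cone_cauchy (R : realType) (E : completeNormedModType R) (P : set E)
  (M : coneMetricType P) (u : nat -> M) : Prop :=
  forall c : E, cone_ll P 0 c ->
    exists n0 : nat, forall n m : nat, (n0 <= n)%N -> (n0 <= m)%N ->
      cone_ll P (cdist (u n) (u m)) c.

Definition cone_complete (R : realType) (E : completeNormedModType R) (P : set E)
  (M : coneMetricType P) : Prop :=
  forall u : nat -> M, cone_cauchy u -> exists x : M, cone_cvg u x.

(* Main.v *)
Require Import Defs.
From mathcomp Require Import all_boot all_order all_algebra.
From mathcomp Require Import lra.
From mathcomp Require Import all_classical all_reals all_analysis.
Import Order.TTheory GRing.Theory Num.Theory.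
Import numFieldNormedType.Exports.
Local Open Scope classical_set_scope.
Local Open Scope ring_scope.

(* Pick x_n with T x_{n+1} = S x_n and put w_n = S x_n.  The Kannan-type
   condition gives d(w_{n+1}, w_n) <= (b / (1 - b)) d(w_n, w_{n-1}), and then
   d(w_{n+1}, w_{m+1}) <= b [d(w_{n+1}, w_n) + d(w_{m+1}, w_m)] makes (w_n) Cauchy
   without summing a geometric series.  Let z be its limit.  Continuity of T gives
   T w_n --> T z, and S w_n = T w_{n+1} by commutation; comparing S z with S w_n
   yields d(Sz, Tz) <= b d(Sz, Tz) + c for every c >> 0, hence S z = T z.  The
   condition forces S to take one value on all coincidence points of S and T;
   as z and S z are both such points, S z is the unique common fixed point. *)

(** * Algebra of the cone and of its interior *)

Lemma coneD {R : realType} {E : completeNormedModType R} {P : set E} x y :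
  is_cone P -> P x -> P y -> P (x + y).
Proof.
move=> [_ _ _ Pcomb _] Px Py; rewrite -[x]scale1r -[y]scale1r.
exact: Pcomb.
Qed.

Lemma coneZ {R : realType} {E : completeNormedModType R} {P : set E} (a : R) x :
  is_cone P -> 0 <= a -> P x -> P (a *: x).
Proof.
move=> [_ _ _ Pcomb _] a0 Px; rewrite -[a *: x]addr0 -[in X in _ + X](scale0r x).
exact: Pcomb.
Qed.

Lemma cone0 {R : realType} {E : completeNormedModType R} {P : set E} :
  is_cone P -> P 0.
Proof.
by move=> hP; have [_ [x Px] _ _ _] := hP; rewrite -(scale0r x); exact: coneZ.
Qed.

Lemma cone_anti {R : realType} {E : completeNormedModType R} {P : set E} x :
  is_cone P -> P x -> P (- x) -> x = 0.
Proof.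
move=> [_ _ _ _ PN] Px PNx.
suff : (P `&` [set - x | x in P]) x by rewrite PN.
by split=> //; exists (- x); rewrite ?opprK.
Qed.

(** Translation by [y] carries a neighbourhood of [x] inside [P] to one of [x + y], still inside [P]
    since [P + y] is contained in [P]. *)
Lemma interior_coneD {R : realType} {E : completeNormedModType R} {P : set E} x y :
  is_cone P -> interior P x -> P y -> interior P (x + y).
Proof.
move=> hP Px Py.
have shift_cvg : (fun z : E => z - y) @ (x + y) --> x.
  rewrite -[X in _ --> X](addrK y); apply: cvgB; [exact: cvg_id|exact: cvg_cst].
apply: (filterS (F := nbhs (x + y)) _ (shift_cvg _ Px)) => z /= Pz.
by rewrite -(subrK y z); exact: coneD.
Qed.

Lemma interior_coneZ {R : realType} {E : completeNormedModType R} {P : set E}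
  (a : R) x :
  is_cone P -> 0 < a -> interior P x -> interior P (a *: x).
Proof.
move=> hP a0 Px.
have scale_cvg : (fun z : E => a^-1 *: z) @ (a *: x) --> x.
  rewrite -[X in _ --> X](scalerK (lt0r_neq0 a0)).
  by apply: cvgZr; exact: cvg_id.
apply: (filterS (F := nbhs (a *: x)) _ (scale_cvg _ Px)) => z /= Pz.
by rewrite -(scalerKV (lt0r_neq0 a0) z); apply: coneZ => //; exact: ltW.
Qed.

(** * Calculus of the relations [cone_le] and [cone_ll] *)

Lemma cone_le_refl {R : realType} {E : completeNormedModType R} {P : set E} x :
  is_cone P -> cone_le P x x.
Proof. by move=> hP; rewrite /cone_le subrr; exact: cone0. Qed.

Lemma cone_le_trans {R : realType} {E : completeNormedModType R} {P : set E} y x z :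
  is_cone P -> cone_le P x y -> cone_le P y z -> cone_le P x z.
Proof.
by move=> hP xy yz; rewrite /cone_le -(subrKA y); exact: coneD.
Qed.

Lemma cone_leD {R : realType} {E : completeNormedModType R} {P : set E} x y z t :
  is_cone P -> cone_le P x y -> cone_le P z t -> cone_le P (x + z) (y + t).
Proof.
by move=> hP xy zt; rewrite /cone_le opprD addrACA; exact: coneD.
Qed.

Lemma cone_leZ {R : realType} {E : completeNormedModType R} {P : set E} (a : R) x y :
  is_cone P -> 0 <= a -> cone_le P x y -> cone_le P (a *: x) (a *: y).
Proof.
by move=> hP a0 xy; rewrite /cone_le -scalerBr; exact: coneZ.
Qed.

Lemma cone_leZl {R : realType} {E : completeNormedModType R} {P : set E} (a b : R) x :
  is_cone P -> a <= b -> P x -> cone_le P (a *: x) (b *: x).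
Proof.
by move=> hP ab Px; rewrite /cone_le -scalerBl; apply: coneZ; rewrite ?subr_ge0.
Qed.

Lemma cone_llW {R : realType} {E : completeNormedModType R} {P : set E} x y :
  cone_ll P x y -> cone_le P x y.
Proof. exact: interior_subset. Qed.

Lemma cone_le_ll_trans {R : realType} {E : completeNormedModType R} {P : set E} y x z :
  is_cone P -> cone_le P x y -> cone_ll P y z -> cone_ll P x z.
Proof.
by move=> hP xy yz; rewrite /cone_ll -(subrKA y); exact: interior_coneD.
Qed.

Lemma cone_llD {R : realType} {E : completeNormedModType R} {P : set E} x y z t :
  is_cone P -> cone_ll P x y -> cone_ll P z t -> cone_ll P (x + z) (y + t).
Proof.
move=> hP xy /cone_llW zt; rewrite /cone_ll opprD addrACA.
exact: interior_coneD.
Qed.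

Lemma cone_llZ0 {R : realType} {E : completeNormedModType R} {P : set E} (a : R) c :
  is_cone P -> 0 < a -> cone_ll P 0 c -> cone_ll P 0 (a *: c).
Proof. by move=> hP a0; rewrite /cone_ll !subr0; exact: interior_coneZ. Qed.

(** Move [b *: x] to the left and divide by [1 - b > 0]. This serves whenever the distance being
    estimated reappears in its own bound. *)
Lemma cone_le_absorb {R : realType} {E : completeNormedModType R} {P : set E}
  (b : R) x y :
  is_cone P -> b < 1 -> cone_le P x (b *: x + y) ->
  cone_le P x ((1 - b)^-1 *: y).
Proof.
move=> hP b1 xy; have b1' : 0 < 1 - b by rewrite subr_gt0.
have {xy} xy : P (y - (1 - b) *: x).
  by rewrite scalerBl scale1r opprB addrA [y + _]addrC.
rewrite /cone_le -[X in _ - X](scalerK (lt0r_neq0 b1')) -scalerBr.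
by apply: coneZ => //; rewrite invr_ge0 ltW.
Qed.

(** Take for [c] the multiples of an interior point by [1 / (n + 1)]: they tend to 0, and [P] is
    closed. *)
Lemma cone_le0_of_ll {R : realType} {E : completeNormedModType R} {P : set E} x :
  is_cone P -> interior P !=set0 ->
  (forall c, cone_ll P 0 c -> cone_le P x c) -> cone_le P x 0.
Proof.
move=> hP [c0 Pc0] xc; have [Pcl _ _ _ _] := hP.
have lim : (fun n => harmonic n *: c0 - x) @ \oo --> 0 - x.
  apply: cvgB; last exact: cvg_cst.
  by rewrite -[X in _ --> X](scale0r c0); apply: cvgZl; exact: cvg_harmonic.
apply: (closed_cvg P Pcl _ _ lim); apply: nearW => n.
apply: xc; apply: cone_llZ0 => //; first exact: harmonic_gt0.
by rewrite /cone_ll subr0.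
Qed.

(** The vectors [c - h ^+ n *: v] tend to [c], which has [interior P] as a neighbourhood. *)
Lemma cone_ll_geometric {R : realType} {E : completeNormedModType R} {P : set E}
  (h : R) v c :
  `|h| < 1 -> cone_ll P 0 c ->
  exists N, forall n, (N <= n)%N -> cone_ll P (h ^+ n *: v) c.
Proof.
rewrite /cone_ll subr0 => h1 Pc.
have lim : (fun n => c - h ^+ n *: v) @ \oo --> c.
  rewrite -[X in _ --> X]subr0; apply: cvgB; first exact: cvg_cst.
  by rewrite -[X in _ --> X](scale0r v); apply: cvgZl; exact: cvg_expr.
have [N _ HN] := lim _ (open_nbhs_nbhs (conj (open_interior P) Pc)).
by exists N.
Qed.

(** * Convergence in the cone metric and in the sub-basis topology *)

Lemma cone_cdist {R : realType} {E : completeNormedModType R} {P : set E}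
  {M : coneMetricType P} (x y : M) : P (cdist x y).
Proof. by rewrite -[cdist x y]subr0; exact: cdist_ge0. Qed.

Lemma cdist_le0_eq {R : realType} {E : completeNormedModType R} {P : set E}
  {M : coneMetricType P} (x y : M) :
  is_cone P -> cone_le P (cdist x y) 0 -> x = y.
Proof.
move=> hP; rewrite /cone_le add0r => d_le0; apply/cdist_eq0.
by apply: (cone_anti _ hP) => //; exact: cone_cdist.
Qed.

Lemma cdistxx {R : realType} {E : completeNormedModType R} {P : set E}
  {M : coneMetricType P} (x : M) : cdist x x = 0.
Proof. exact/cdist_eq0. Qed.

(** By the triangle inequality, the ball around [x] of radius [c - cdist x b] lies in
    [cone_ball b c]. *)
Lemma cone_ball_near {R : realType} {E : completeNormedModType R} {P : set E}
  {M : coneMetricType P} (u : nat -> M) (x b : M) c :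
  is_cone P -> cone_cvg u x -> cone_ball b c x ->
  \forall n \near \oo, cone_ball b c (u n).
Proof.
move=> hP ux xb.
have [N HN] := ux (c - cdist x b) ltac:(by rewrite /cone_ll subr0).
exists N => // n /HN un; apply: (cone_le_ll_trans _ _ _ hP (cdist_triangle _ _ x)).
by rewrite /cone_ll opprD addrA addrAC.
Qed.

Lemma cone_cvg_cvg {R : realType} {E : completeNormedModType R} {P : set E}
  {M : coneMetricType P} (u : nat -> M) (x : M) :
  is_cone P -> cone_cvg u x -> u @ \oo --> x.
Proof.
move=> hP ux A; rewrite nbhsE => -[B [[D sD <-] [C DC Cx]] BA].
have [F sF CE] := sD _ DC.
suff : \forall n \near \oo, C (u n).
  by apply: filterS => n Cu; apply: BA; exists C.
(* A basic open set is a finite intersection of cone balls, so each ball can be treated alone. *)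
rewrite -CE; apply: (filter_bigI (F := u @ \oo)) => B' B'F.
have := sF _ B'F; rewrite inE => -[b [c [_ B'E]]].
rewrite B'E; apply: (cone_ball_near _ _ _ _ hP ux).
by rewrite -B'E; have : C x := Cx; rewrite -CE; apply.
Qed.

Lemma cvg_cone_cvg {R : realType} {E : completeNormedModType R} {P : set E}
  {M : coneMetricType P} (u : nat -> M) (x : M) :
  u @ \oo --> x -> cone_cvg u x.
Proof.
move=> ux c c0.
have /ux [N _ HN] : nbhs x (cone_ball x c).
  rewrite nbhsE; exists (cone_ball x c) => //; split.
    exists [set cone_ball x c]; last by rewrite bigcup_set1.
    move=> _ ->; apply: finI_from1; by exists x, c.
  by rewrite /cone_ball /= cdistxx.
by exists N.
Qed.

Lemma continuous_cone_cvg {R : realType} {E : completeNormedModType R} {P : set E}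
  {M : coneMetricType P} (T : M -> M) (u : nat -> M) (x : M) :
  is_cone P -> continuous T -> cone_cvg u x -> cone_cvg (T \o u) (T x).
Proof.
move=> hP Tc /(cone_cvg_cvg _ _ hP) ux; apply: cvg_cone_cvg.
exact: (cvg_comp _ _ ux (Tc x)).
Qed.

(** * Consequences of the Kannan-type condition *)

Definition jungck_kannan {R : realType} {E : completeNormedModType R} {P : set E}
  {M : coneMetricType P} (S T : M -> M) (b : R) :=
  forall x y : M, cone_le P (cdist (S x) (S y))
    (b *: (cdist (S x) (T x) + cdist (S y) (T y))).

(** The count starts at [x 1], because [T (x 0)] need not be a value of [S] along the sequence. *)
Lemma jungck_kannan_decay {R : realType} {E : completeNormedModType R} {P : set E}
  {M : coneMetricType P} (S T : M -> M) (b : R) (x : nat -> M) n :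
  is_cone P -> 0 <= b -> b < 1 -> jungck_kannan S T b ->
  (forall n, T (x n.+1) = S (x n)) ->
  cone_le P (cdist (S (x n.+1)) (T (x n.+1)))
    (((1 - b)^-1 * b) ^+ n *: cdist (S (x 1%N)) (T (x 1%N))).
Proof.
move=> hP b0 b1 hST xS; elim: n => [|n IH].
  by rewrite expr0 scale1r; exact: cone_le_refl.
rewrite exprS -scalerA -[X in cone_le _ _ X]scalerA.
apply: cone_le_absorb => //.
(* As [T (x n.+2) = S (x n.+1)], the left-hand distance recurs on the right with coefficient [b] and
   can be absorbed. *)
have := hST (x n.+2) (x n.+1); rewrite scalerDr !(xS n.+1) => hS.
apply: (cone_le_trans _ _ _ hP hS); apply: cone_leD => //.
  exact: cone_le_refl.
exact: cone_leZ.
Qed.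

Lemma jungck_kannan_cauchy {R : realType} {E : completeNormedModType R} {P : set E}
  {M : coneMetricType P} (S T : M -> M) (b : R) (x : nat -> M) :
  is_cone P -> 0 <= b -> b < 1 / 2 -> jungck_kannan S T b ->
  (forall n, T (x n.+1) = S (x n)) ->
  cone_cauchy (fun n => S (x n.+1)).
Proof.
move=> hP b0 b2 hST xS c c0; have b1 : b < 1 by lra.
(* The ratio [b / (1 - b)] is below 1 exactly because [b < 1 / 2]. *)
have h1 : `|(1 - b)^-1 * b| < 1.
  rewrite ger0_norm ?mulr_ge0 ?invr_ge0 ?subr_ge0 ?(ltW b1)//.
  rewrite mulrC ltr_pdivrMr ?subr_gt0//; lra.
have c20 : cone_ll P 0 (2^-1 *: c) by exact: cone_llZ0.
have [N HN] := cone_ll_geometric _ (cdist (S (x 1%N)) (T (x 1%N))) _ h1 c20.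
have small n : (N <= n)%N -> cone_ll P (cdist (S (x n.+1)) (T (x n.+1))) (2^-1 *: c).
  move=> /HN HNn; apply: (cone_le_ll_trans _ _ _ hP _ HNn).
  exact: (jungck_kannan_decay S T b x).
exists N => n m Nn Nm; apply: (cone_le_ll_trans _ _ _ hP (hST _ _)).
have -> : c = 2^-1 *: c + 2^-1 *: c by rewrite -scalerDl -div1r -splitr scale1r.
apply: (cone_le_ll_trans _ _ _ hP _ (cone_llD _ _ _ _ hP (small n Nn) (small m Nm))).
(* Since [b <= 1], the factor [b] can be replaced by 1. *)
rewrite -[X in cone_le _ _ X]scale1r; apply: cone_leZl => //; first exact: ltW.
by apply: coneD => //; exact: cone_cdist.
Qed.

Lemma jungck_kannan_coincidence {R : realType} {E : completeNormedModType R}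
  {P : set E} {M : coneMetricType P} (S T : M -> M) (b : R) (w : nat -> M) (z : M) :
  is_cone P -> interior P !=set0 -> 0 <= b -> b < 1 / 2 ->
  jungck_kannan S T b -> (forall n, S (w n) = T (w n.+1)) ->
  cone_cvg (T \o w) (T z) -> S z = T z.
Proof.
move=> hP Pint b0 b2 hST Sw Tw; have b1 : b < 1 by lra.
apply: cdist_le0_eq => //; apply: cone_le0_of_ll => // c c0.
(* Chosen so that [(1 - b)^-1 *: (e + e) = c], the bound left after absorption. *)
pose e := ((1 - b) / 2) *: c.
have e0 : cone_ll P 0 e by apply: cone_llZ0 => //; lra.
have Pe : P e by have := cone_llW _ _ e0; rewrite /cone_le subr0.
have [N HN] := Tw e e0.
(* Both [T (w N)] and [T (w N.+1) = S (w N)] are within [e] of [T z], hence within [e + e] of each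
   other. *)
have TN1 := cone_llW _ _ (HN N.+1 (leqnSn N)).
have TN := cone_llW _ _ (HN N (leqnn N)).
have -> : c = (1 - b)^-1 *: (e + e).
  rewrite -scalerDl scalerA -splitr mulVf ?scale1r//.
  by rewrite subr_eq0 gt_eqF.
apply: cone_le_absorb => //.
apply: (cone_le_trans _ _ _ hP (cdist_triangle _ _ (S (w N)))).
rewrite addrA; apply: cone_leD => //; last by rewrite Sw.
apply: (cone_le_trans _ _ _ hP (hST _ _)); rewrite scalerDr.
apply: cone_leD => //; first exact: cone_le_refl.
apply: (cone_le_trans (b *: (e + e))) => //.
  apply: cone_leZ => //; apply: (cone_le_trans _ _ _ hP (cdist_triangle _ _ (T z))).
  by apply: cone_leD => //; rewrite ?Sw// cdist_sym.
(* Here [b *: (e + e)] is at most [e], since [2 b <= 1]. *)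
rewrite -mulr2n -scaler_nat scalerA -[X in cone_le _ _ X]scale1r.
by apply: cone_leZl => //; lra.
Qed.

(** At coincidence points both distances on the right of the condition vanish. *)
Lemma jungck_kannan_fixed_eq {R : realType} {E : completeNormedModType R}
  {P : set E} {M : coneMetricType P} (S T : M -> M) (b : R) (x y : M) :
  is_cone P -> jungck_kannan S T b -> S x = T x -> S y = T y -> S x = S y.
Proof.
move=> hP hST Sx Sy; apply: cdist_le0_eq => //.
by have := hST x y; rewrite -Sx -Sy !cdistxx addr0 scaler0.
Qed.

Theorem corollary2p3 (R : realType) (E : completeNormedModType R) (P : set E)
  (hP : is_cone P) (hPint : interior P !=set0)
  (K : R) (hPnormal : normal_cone P) (hK : is_normal_constant P K)
  (M : coneMetricType P) (hM : cone_complete M)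
  (S T : M -> M)
  (ha : continuous T)
  (hb : range S `<=` range T)
  (hc : forall x : M, S (T x) = T (S x))
  (hd : exists b : R, 0 <= b /\ b < 1 / 2 /\
     forall x y : M, cone_le P (cdist (S x) (S y))
       (b *: (cdist (S x) (T x) + cdist (S y) (T y)))) :
  exists! z : M, S z = z /\ T z = z.
Proof.
have [b [b0 [b2 hST]]] := hd.
have /choice [g gS] x : exists y, T y = S x.
  by have [y _ <-] := hb (S x) (imageT S x); exists y.
have [x0] := cm_inhabited M.
pose x n := iter n g x0.
have xS n : T (x n.+1) = S (x n) by exact: gS.
have [z wz] := hM _ (jungck_kannan_cauchy S T b x hP b0 b2 hST xS).
have Sz : S z = T z.
  apply: (jungck_kannan_coincidence S T b (fun n => S (x n.+1))) => //.
    (* [S (S (x n.+1)) = S (T (x n.+2)) = T (S (x n.+2))]. *)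
    by move=> n; rewrite -[in RHS]hc xS.
  exact: continuous_cone_cvg.
have STz : S (S z) = T (S z) by rewrite [in LHS]Sz hc.
have SSz : S (S z) = S z by exact: (jungck_kannan_fixed_eq S T b).
exists (S z); split; first by rewrite -STz.
(* A common fixed point [y] is a coincidence point, so [y = S y = S z]. *)
move=> y [Sy Ty]; rewrite -[RHS]Sy.
by apply: (jungck_kannan_fixed_eq S T b) => //; rewrite Sy Ty.
Qed.
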